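(* There are no integers $a, b, n$ with $a>b>0$, $\gcd(n,3)=1$, and $2<n\leq 2+6\cdot 10^6$ such that $3^{a}+3^{b}+2=n^5$.
   Context: All variables $a,b$ are positive integers and $n$ is a non-negative integer. *)

From Stdlib Require Import ZArith.
From Stdlib Require Import Zpow_facts List Bool Lia.
Open Scope Z_scope.

(** The bound on [n] gives [3 ^ a < n ^ 5 < 3 ^ 72], so [a <= 71] and only
    finitely many pairs [b < a] remain.  Each of them is tested for being a fifth
    power modulo the primes 61, 41, 11 and 31 ([no_small_pair]).  These primes are
    1 modulo 5, so that only one nonzero residue in five is a fifth power, and the
    order of 3 modulo each of them is small (10, 8, 5 and 30).  Congruences cannot
    exclude [(a, b) = (3, 1)], because [3 ^ 3 + 3 ^ 1 + 2 = 2 ^ 5]; it is the only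
    pair that passes all four tests, and there [n ^ 5 = 32] contradicts [2 < n]. *)

Definition interval (k : nat) : list Z := map Z.of_nat (seq 0 k).

Definition fifth_power_modb (v m : Z) : bool :=
  existsb (fun r => r ^ 5 mod m =? v mod m) (interval (Z.to_nat m)).

Definition sieve_moduli : list Z := 61 :: 41 :: 11 :: 31 :: nil.

Lemma in_interval (k : nat) (x : Z) : 0 <= x < Z.of_nat k -> In x (interval k).
Proof.
  intros Hx; apply in_map_iff; exists (Z.to_nat x); split.
  - lia.
  - apply in_seq; lia.
Qed.

Lemma fifth_power_modb_pow (n m : Z) : 0 < m -> fifth_power_modb (n ^ 5) m = true.
Proof.
  intros Hm; apply existsb_exists; exists (n mod m).
  pose proof (Z.mod_pos_bound n m Hm) as Hr; split.
  - apply in_interval; lia.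
  - apply Z.eqb_eq; symmetry; apply Zpower_mod; lia.
Qed.

Lemma forallb_fifth_power_modb_pow (n : Z) :
  forallb (fifth_power_modb (n ^ 5)) sieve_moduli = true.
Proof.
  apply forallb_forall; intros m Hm; apply fifth_power_modb_pow.
  simpl in Hm; lia.
Qed.

(** The only step that needs computation: [72] is the bound of [exponent_bound]
    below, and none of the four moduli is enough by itself. *)
Lemma no_small_pair :
  forallb (fun a => forallb (fun b =>
      if (0 <? b) && (b <? a) then
        if forallb (fifth_power_modb (3 ^ a + 3 ^ b + 2)) sieve_moduli
        then (a =? 3) && (b =? 1) else true
      else true) (interval 72)) (interval 72) = true.
Proof. vm_compute; reflexivity. Qed.

Lemma small_pair_eq (a b n : Z) :
  0 < b < a -> a < 72 -> 3 ^ a + 3 ^ b + 2 = n ^ 5 -> a = 3 /\ b = 1.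
Proof.
  intros Hba Ha E.
  pose proof (proj1 (forallb_forall _ _) no_small_pair a
    (in_interval 72 a ltac:(lia))) as H.
  pose proof (proj1 (forallb_forall _ _) H b (in_interval 72 b ltac:(lia))) as Hb.
  cbv beta in Hb.
  rewrite (proj2 (Z.ltb_lt 0 b)), (proj2 (Z.ltb_lt b a)), E,
    forallb_fifth_power_modb_pow in Hb by lia.
  apply andb_true_iff in Hb; lia.
Qed.

Lemma exponent_bound (a b n : Z) :
  0 < n <= 6000002 -> 3 ^ a + 3 ^ b + 2 = n ^ 5 -> a < 72.
Proof.
  intros Hn E.
  assert (Hn5 : n ^ 5 <= 6000002 ^ 5) by (apply Z.pow_le_mono_l; lia).
  assert (Hlt : 6000002 ^ 5 < 3 ^ 72) by reflexivity.
  assert (Hb : 0 <= 3 ^ b) by (apply Z.pow_nonneg; lia).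
  destruct (Z.lt_ge_cases a 72) as [Ha | Ha]; [exact Ha | exfalso].
  apply (Z.pow_le_mono_r 3 72 a) in Ha; lia.
Qed.

Theorem theorem1 :
  ~ exists a b n : Z,
      a > b /\ b > 0 /\
      Z.gcd n 3 = 1 /\
      2 < n <= 2 + 6 * 10 ^ 6 /\
      3 ^ a + 3 ^ b + 2 = n ^ 5.
Proof.
  intros (a & b & n & Hab & Hb & _ & Hn & E).
  assert (Ha : a < 72) by (apply (exponent_bound a b n); [lia | exact E]).
  destruct (small_pair_eq a b n) as [-> ->]; [lia | exact Ha | exact E |].
  assert (H3 : 3 ^ 5 <= n ^ 5) by (apply Z.pow_le_mono_l; lia).
  lia.
Qed.
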